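(* Let $n$ and $k$ be fixed positive integers, with $k<n$. Write $s=\lfloor (n-1)/k\rfloor$, so $n=sk+r$ where $1\leq r\leq k$. Define $d_k=\gcd(n,k)$ and $d_s=\gcd(n,s)$. Then: (1) If $r\geq s$ or $k=r$, then $\sigma(n,k)=\lfloor (n-1)/k\rfloor$. (2) If $r<s$ and $r<k$ and $d_sd_k$ divides $n$, then $\sigma(n,k)=\lfloor (n-1)/k\rfloor$. (3) If $r<s$ and $r<k$ and $d_sd_k$ does not divide $n$, then $\sigma(n,k)=\lfloor (n-1)/k\rfloor-1$.
   Context: For $i,j\in\mathbb{Z}_n$ define $||i,j||_n=\min\{(i-j)\bmod n,(j-i)\bmod n\}$, where $x \bmod n$ denotes the representative in $\{0,1,\ldots,n-1\}$. For positive integers $s,k$, a permutation $\pi:\mathbb{Z}_n\to\mathbb{Z}_n$ is $(s,k)$-clash-free if $||\pi(i),\pi(j)||_n\geq k$ for all distinct $i,j\in\mathbb{Z}_n$ with $||i,j||_n<s$. For integers $n$ and $k$ with $1\leq k<n$, $\sigma(n,k)$ is defined to be the largest value of $s$ such that an $(s,k)$-clash-free permutation of $\mathbb{Z}_n$ exists.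
   Formalization: Here σ(n,k) is the largest s with 1 ≤ s < n for which an (s,k)-clash-free permutation exists; the bound s < n matters only for k = 1, where every permutation is (s,1)-clash-free for all s and no largest s exists. *)

(* Defs.v *)
From mathcomp Require Import all_boot all_order all_algebra all_fingroup.
Set Implicit Arguments.
Unset Strict Implicit.
Unset Printing Implicit Defensive.

(* As 'Z_n is the ring of integers mod (max n 2), these definitions are       *)
(* meaningful only for 1 < n. The two differences are taken in 'Z_n and then  *)
(* coerced to their representatives in {0, ..., n - 1}.                       *)
Definition zdist (n : nat) (i j : 'Z_n) : nat := minn (i - j)%R (j - i)%R.

Definition clash_free (n s k : nat) (pi : {perm 'Z_n}) : bool :=
  [forall i, forall j,
    (i != j) && (zdist i j < s) ==> (k <= zdist (pi i) (pi j))].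

(* The range s < n only matters for k = 1, where every permutation is         *)
(* (s, 1)-clash-free for every s and there is no largest s at all; for 1 < k  *)
(* it excludes no s (clash_free_ltn), and sigma is the unrestricted maximum   *)
(* (sigma_largest).                                                           *)
Definition sigma (n k : nat) : nat :=
  \max_(1 <= s < n | [exists pi : {perm 'Z_n}, clash_free s k pi]) s.

Lemma zdist_lt (n : nat) (i j : 'Z_n) : 1 < n -> zdist i j < n.
Proof.
move=> n_gt1; rewrite /zdist; apply: leq_ltn_trans (geq_minl _ _) _.
by rewrite -[X in _ < X](Zp_cast n_gt1) ltn_ord.
Qed.

Lemma clash_free_ltn (n s k : nat) (pi : {perm 'Z_n}) :
  1 < n -> 1 < k -> clash_free s k pi -> s < n.
Proof.
move=> n_gt1 k_gt1 /forallP cf; rewrite ltnNge; apply/negP => le_ns.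
have /forallP/(_ ((pi^-1)%g 0%R)) := cf ((pi^-1)%g 1%R).
rewrite (inj_eq perm_inj) GRing.oner_neq0 /=.
rewrite (leq_trans (zdist_lt _ _ n_gt1) le_ns) !permKV /=.
apply/negP; rewrite -ltnNge (leq_ltn_trans _ k_gt1) //.
by rewrite /zdist GRing.subr0 geq_minl.
Qed.

Lemma clash_free1 (n k : nat) (pi : {perm 'Z_n}) : clash_free 1 k pi.
Proof.
apply/forallP => i; apply/forallP => j; apply/implyP => /andP[/eqP ij].
have eq0 (x : 'Z_n) : (x : nat) = 0 -> x = 0%R by move=> x0; apply: val_inj.
rewrite /zdist ltnS leqn0 => /eqP; rewrite /minn; case: ifP => _ /eq0 /eqP.
  by rewrite GRing.subr_eq0 => /eqP.
by rewrite GRing.subr_eq0 eq_sym => /eqP.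
Qed.

Lemma sigma_largest (n k : nat) : 1 < k < n ->
  [/\ 0 < sigma n k,
      exists pi : {perm 'Z_n}, clash_free (sigma n k) k pi
    & forall s (pi : {perm 'Z_n}), clash_free s k pi -> s <= sigma n k].
Proof.
move=> /andP[k_gt1 lt_kn]; have n_gt1 := ltn_trans k_gt1 lt_kn.
pose P s := [exists pi : {perm 'Z_n}, clash_free s k pi].
have le_sigma s (pi : {perm 'Z_n}) : clash_free s k pi -> s <= sigma n k.
  case: s => // s cf; have lt_sn := clash_free_ltn n_gt1 k_gt1 cf.
  apply: (@leq_bigmax_seq _ _ P id); first by rewrite mem_index_iota.
  by apply/existsP; exists pi.
split=> //; first exact: le_sigma (clash_free1 k 1%g).
have: (sigma n k == 0) || P (sigma n k).
  rewrite /sigma; apply: (big_ind (fun m => (m == 0) || P m)) => [//|x y|i Pi].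
    by rewrite /maxn; case: ifP.
  by rewrite [P i]Pi orbT.
case/orP => [/eqP s0|/existsP//].
by have := le_sigma 1 1%g (clash_free1 k 1%g); rewrite s0.
Qed.

(* Main.v *)
Require Import Defs.
From mathcomp Require Import all_boot all_order all_algebra all_fingroup.
From mathcomp Require Import all_solvable zify ring.

(* A permutation pi is (s, k)-clash-free if and only if the n rectangles of
   size s x k with lower left corners (i, pi i) are disjoint in the n x n torus.
   Looking at s consecutive columns gives s k <= n; if n = s k then the
   rectangles starting in columns i and i + s would coincide.

   If n >= (q + 1) p, a (p, q)-clash-free permutation is obtained by advancing by
   q + 1 at each step, with corrections that first climb slowly through the
   cosets of the subgroup generated by q + 1 and then come down quickly.

   When r < s and r < k, the packing is so tight that the rectangles starting in
   columns i and i + s differ in height by at most r, and likewise for rows. Four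
   neighbouring rectangles then form a pinwheel around a hole, which says that the
   permutations t : i -> i + s and u : i -> pi^-1 (pi i - k) commute. They
   generate a transitive group, so n divides #[t] #[u], which divides
   (n / gcd(n, s)) (n / gcd(n, k)). Conversely, if gcd(n, s) gcd(n, k) divides n,
   such a pinwheel packing can be built, with corners (s a + S b, D a - k b) for
   staircase functions S and D. *)

Set Implicit Arguments.
Unset Strict Implicit.
Unset Printing Implicit Defensive.
Import Order.TTheory GRing.Theory Num.Theory.

(** * Clash-free permutations as packings *)

Section ClashFree.
Local Open Scope ring_scope.
Variables (n : nat) (n_gt1 : (1 < n)%N).
Implicit Types (i j : 'Z_n) (X Y : int) (pi : {perm 'Z_n}).

Lemma intrZn_eq0 X : (X%:~R == 0 :> 'Z_n) = (n %| X)%Z.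
Proof.
have natE (m : nat) : (m%:R == 0 :> 'Z_n) = (n %| m)%N.
  by rewrite -val_eqE /= val_Zp_nat.
by case: X => m; rewrite ?NegzE ?mulrNz ?oppr_eq0 -pmulrn natE dvdzE ?abszN.
Qed.

Lemma intrZn_eq X Y :
  X%:~R = Y%:~R :> 'Z_n -> exists q : int, X = Y + q * n%:Z.
Proof.
move=> /eqP; rewrite -subr_eq0 -intrB intrZn_eq0 => /dvdzP[q Eq].
by exists q; rewrite -Eq addrC subrK.
Qed.

Lemma intrZn_small X : `|X| < n%:Z -> X%:~R = 0 :> 'Z_n -> X = 0.
Proof.
move=> ltX /(intrZn_eq (Y := 0))[q]; rewrite add0r => Eq.
move: ltX; rewrite {X}Eq normrM.
case: (eqVneq q 0) => [->|q0]; first by rewrite mul0r.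
by rewrite ltNge ler_peMl //; lia.
Qed.

Lemma natZnK i : (i : nat)%:~R = i.
Proof. by rewrite -pmulrn natr_Zp. Qed.

Lemma zdistP s i j :
  reflect (exists2 X, `|X| < s%:Z & j = i + X%:~R) (zdist i j < s)%N.
Proof.
have valE (X : int) : 0 <= X -> X < s%:Z -> ((X%:~R : 'Z_n) < s)%N.
  case: X => // m _ ltm; rewrite -pmulrn val_Zp_nat //.
  exact: leq_ltn_trans (leq_mod _ _) _.
apply: (iffP idP) => [|[X ltX ->]].
  rewrite /zdist gtn_min => /orP[] lt_s.
    by exists (- Posz (i - j)%R); [lia | rewrite intrN natZnK opprB addrC subrK].
  by exists (Posz (j - i)%R); [lia | rewrite natZnK addrC subrK].
rewrite /zdist gtn_min opprD addNKr addrC addKr -intrN.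
by case: (lerP 0 X) => X0; apply/orP; [right|left]; apply: valE; lia.
Qed.

(** When [s] exceeds [n], [X] may be a nonzero multiple of [n]; hence the conclusion in ['Z_n]. *)
Lemma clash_freeP s k pi :
  reflect (forall i X Y, `|X| < s%:Z -> `|Y| < k%:Z ->
             pi (i + X%:~R) = pi i + Y%:~R -> X%:~R = 0 :> 'Z_n)
          (clash_free s k pi).
Proof.
apply: (iffP forallP) => [cf i X Y ltX ltY E | cf i].
  apply/eqP; apply: contraT => X0.
  have /forallP/(_ (i + X%:~R))/implyP := cf i; rewrite -subr_eq0 opprD addNKr.
  rewrite oppr_eq0 X0 => /(_ (introT (zdistP _ _ _) (ex_intro2 _ _ X ltX erefl))).
  by rewrite leqNgt => /negP[]; apply/zdistP; exists Y.
apply/forallP => j; apply/implyP => /andP[neq_ij /zdistP[X ltX Ej]].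
rewrite leqNgt; apply: contraNN neq_ij => /zdistP[Y ltY EY].
by rewrite Ej (cf i X Y) ?addr0 // -Ej.
Qed.

Lemma clash_freeV s k pi : clash_free s k pi -> clash_free k s (pi^-1)%g.
Proof.
move=> /clash_freeP cf; apply/clash_freeP => i X Y ltX ltY E.
have E' : pi ((pi^-1)%g i + Y%:~R) = pi ((pi^-1)%g i) + X%:~R.
  by rewrite -E !permKV.
have Y0 := cf _ _ _ ltY ltX E'.
by move: E'; rewrite Y0 addr0 -[LHS]addr0 => /addrI.
Qed.

Lemma clash_freeN s k pi :
  clash_free s k pi -> clash_free s k (perm (@oppr_inj 'Z_n) * pi)%g.
Proof.
move=> /clash_freeP cf; apply/clash_freeP => i X Y ltX ltY.
rewrite !permM !permE opprD -intrN => /(cf _ _ _ _ ltY).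
by rewrite normrN intrN => /(_ ltX)/eqP; rewrite oppr_eq0 => /eqP.
Qed.

Lemma clash_free_pos s k pi :
  (forall i (j : nat) Y, (0 < j < s)%N -> `|Y| < k%:Z ->
     pi (i + j%:~R) <> pi i + Y%:~R) ->
  clash_free s k pi.
Proof.
move=> cf; apply/clash_freeP => i X Y ltX ltY E.
case: (ltrgtP X 0) => [X0|X0|-> //].
  case: (cf (i + X%:~R) `|X|%N (- Y)); [lia|lia|].
  by rewrite -addrA -intrD E (_ : X + _ = 0) ?intrN ?addr0 ?addrK //; lia.
case: (cf i `|X|%N Y); [lia| lia|].
by rewrite (_ : (`|X|%N)%:Z = X) //; lia.
Qed.
End ClashFree.

(** * Counting disjoint arcs; the bound on a step of [s] columns *)

Section Packing.
Local Open Scope ring_scope.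
Variables (n : nat) (n_gt1 : (1 < n)%N).
Implicit Types (i j : 'Z_n) (X Y : int) (pi : {perm 'Z_n}).

Lemma intr_addBK X Y : X%:~R + (Y - X)%:~R = Y%:~R :> 'Z_n.
Proof. by rewrite -intrD addrC subrK. Qed.

Lemma packing m k (f : 'I_m -> 'Z_n) : (k <= n)%N ->
  (forall p q Y, `|Y| < k%:Z -> f p = f q + Y%:~R -> p = q) ->
  (m * k <= n)%N.
Proof.
move=> le_kn sepf; pose g (u : 'I_m * 'I_k) := f u.1 + (u.2 : nat)%:~R.
suff /leq_card: injective g by rewrite card_prod !card_ord Zp_cast.
move=> [p t] [q u] /= /eqP; rewrite -subr_eq -addrA -intrN -intrD => /eqP/esym E.
have pq : q = p.
  by apply: sepf E => /=; have := ltn_ord t; have := ltn_ord u; lia.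
rewrite {}pq in E *; congr (_, _); apply: val_inj => /=.
move: E; rewrite -[LHS]addr0 => /addrI/esym/(intrZn_small n_gt1).
by rewrite /=; have := ltn_ord t; have := ltn_ord u; lia.
Qed.

Lemma clash_free_mul_le s k pi :
  (s <= n)%N -> (k <= n)%N -> clash_free s k pi -> (s * k <= n)%N.
Proof.
move=> le_sn le_kn /(clash_freeP n_gt1) cf.
apply: (packing (f := fun p : 'I_s => pi (p : nat)%:~R)) => // p q Y ltY E.
have := cf (q : nat)%:~R (p%:Z - q%:Z) Y; rewrite intr_addBK => H.
apply: val_inj => /=; suff: p%:Z - q%:Z = 0 by lia.
apply: (intrZn_small n_gt1); last apply: H => //;
  by have := ltn_ord p; have := ltn_ord q; lia.
Qed.

(* The [s] rectangles starting in the columns [i, ..., i + s - 1], together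
   with the cells [pi i + k, ..., pi i + k + D - 1], are pairwise disjoint. *)
Lemma step_le s k pi i (D : nat) :
  (1 < s <= n)%N -> (k <= n)%N -> clash_free s k pi -> (D <= k)%N ->
  pi (i + s%:~R) = pi i + D%:~R -> (s * k + D <= n)%N.
Proof.
move=> /andP[s_gt1 le_sn] le_kn cf le_Dk ED.
have sk_n := clash_free_mul_le le_sn le_kn cf.
have kk_n : (k + D <= n)%N by nia.
move/(clash_freeP n_gt1): cf => cf.
pose g (u : 'I_s * 'I_k + 'I_D) := match u with
  | inl (p, t) => pi (i + (p : nat)%:~R) + (t : nat)%:~R
  | inr t => pi i + (k + t)%N%:~R end.
suff /leq_card: injective g by rewrite card_sum card_prod !card_ord Zp_cast.
have eqE (a b : 'Z_n) (t u : nat) :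
    a + t%:~R = b + u%:~R -> b = a + (t%:Z - u%:Z)%:~R.
  by rewrite intrD intrN addrA => ->; rewrite addrK.
have inlr p (t : 'I_k) (u : 'I_D) : g (inl (p, t)) = g (inr u) -> False.
  move=> /= /eqE; have := ltn_ord t; have := ltn_ord u; have := ltn_ord p.
  case: (posnP p) => [->|p0] lt_p lt_u lt_t E.
    move: E; rewrite addr0 -[LHS]addr0 => /addrI/esym/(intrZn_small n_gt1); lia.
  (* As [D <= k], the extra cells lie in the arc of column [i + s], which is less than [s] columns
     away from [i + p] once [0 < p]. *)
  have /cf : `|s%:Z - p%:Z| < s%:Z by lia.
  move=> /(_ (i + (p : nat)%:~R) (D%:Z + (t%:Z - (k + u)%N%:Z))).
  rewrite -addrA intr_addBK ED E -!addrA -intrD.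
  rewrite [_ - _ + _]addrC => H.
  have /(intrZn_small n_gt1) : (s%:Z - p%:Z)%:~R = 0 :> 'Z_n by apply: H => //; lia.
  lia.
move=> [[p t]|t] [[q u]|u] E.
- move/eqE: (E); have := ltn_ord t; have := ltn_ord u.
  have := ltn_ord p; have := ltn_ord q => lt_q lt_p lt_u lt_t E1.
  have pq : q = p.
    have /cf : `|q%:Z - p%:Z| < s%:Z by lia.
    move=> /(_ (i + (p : nat)%:~R) (t%:Z - u%:Z)).
    rewrite -addrA intr_addBK E1 => H.
    have /(intrZn_small n_gt1) : (q%:Z - p%:Z)%:~R = 0 :> 'Z_n by apply: H => //; lia.
    by move=> H1; apply: val_inj => /=; lia.
  rewrite {}pq in E1 *; congr (inl (_, _)); apply: val_inj => /=.
  move: E1; rewrite -[LHS]addr0 => /addrI/esym/(intrZn_small n_gt1); lia.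
- by case: (inlr _ _ _ E).
- by case: (inlr _ _ _ (esym E)).
- congr inr; apply: val_inj => /=; have := ltn_ord t; have := ltn_ord u.
  move: E => /= /eqE; rewrite -[LHS]addr0 => /addrI/esym/(intrZn_small n_gt1); lia.
Qed.

(** Were [pi i] and [pi (i + s)] at least [k] apart, the arcs of [s + 1] consecutive columns would
    be disjoint, against [n < s.+1 * k]. So the step is short and [step_le] bounds it, after
    reflecting the columns if it is negative. *)
Lemma step_bound s k pi i :
  (1 < s < n)%N -> (k <= n)%N -> (n < s.+1 * k)%N -> clash_free s k pi ->
  exists2 D : int, `|D| <= n%:Z - (s * k)%N%:Z & pi (i + s%:~R) = pi i + D%:~R.
Proof.
move=> /andP[s_gt1 lt_sn] le_kn lt_n cf; have /(clash_freeP n_gt1) cfP := cf.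
have s_n : (1 < s <= n)%N by lia.
have [lt_k|le_k] := ltnP (zdist (pi i) (pi (i + s%:~R))) k; last first.
  suff : (s.+1 * k <= n)%N by lia.
  have sep (a b : nat) Y : (a <= b)%N -> (b < s.+1)%N -> `|Y| < k%:Z ->
      pi (i + b%:~R) = pi (i + a%:~R) + Y%:~R -> b = a.
    move=> le_ab lt_b ltY E; have [lt_s|ge_s] := ltnP (b - a) s.
      have := cfP (i + a%:~R) (b%:Z - a%:Z) Y.
      rewrite -addrA intr_addBK => H.
      have /(intrZn_small n_gt1) : (b%:Z - a%:Z)%:~R = 0 :> 'Z_n.
        by apply: H => //; lia.
      lia.
    have [Ea Eb] : a = 0%N /\ b = s by lia.
    move: le_k; rewrite leqNgt => /negP[]; apply/zdistP => //; exists Y => //.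
    by rewrite -Eb E Ea addr0.
  apply: (packing (f := fun p : 'I_s.+1 => pi (i + (p : nat)%:~R))) => //.
  move=> p q Y ltY E; apply: val_inj; case: (leqP q p) => [le_qp|lt_pq] /=.
    exact: sep (ltn_ord p) ltY E.
  apply/esym/(sep _ _ (- Y)) => //; [exact: ltnW| lia |].
  by rewrite E intrN addrK.
have [D ltD ED] := zdistP n_gt1 _ _ _ lt_k; exists D => //.
have le_Dk : (`|D| <= k)%N by lia.
case: (lerP 0 D) => D0.
  have DE : (`|D|%N)%:Z = D by lia.
  have := step_le s_n le_kn cf le_Dk; rewrite DE => /(_ _ ED); lia.
have DE : (`|D|%N)%:Z = - D by lia.
have := step_le s_n le_kn (clash_freeN n_gt1 cf) le_Dk.
move=> /(_ (- (i + s%:~R))).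
rewrite !permM !permE opprK [- (_ + s%:~R)]opprD opprK addrK DE intrN ED addrK.
by move=> /(_ erefl); lia.
Qed.

Lemma clash_free_mul_lt s k pi :
  (s < n)%N -> (0 < k < n)%N -> clash_free s k pi -> (s * k < n)%N.
Proof.
move=> lt_sn k_n cf; have := clash_free_mul_le (ltnW lt_sn) _ cf.
case: (ltnP 1 s) => s_gt1; last by nia.
have le_kn : (k <= n)%N by lia.
move=> /(_ le_kn); rewrite leq_eqVlt => /orP[/eqP E|//].
have [|||D leD] := @step_bound s k pi 0 _ _ _ cf; [lia|lia|nia|].
rewrite (_ : D = 0) ?addr0; last by lia.
rewrite -[in RHS](addr0 0) => /perm_inj/addrI/(intrZn_small n_gt1); lia.
Qed.
End Packing.

(** * The pinwheel structure of tight packings *)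

Section Pinwheel.
Local Open Scope ring_scope.

(* [A X Y] is meant to say that, relative to a chosen point of the graph of the
   permutation, the point shifted by [(X, Y)] is again on the graph. *)
Definition separated (s k : nat) (A : int -> int -> Prop) := forall X Y X' Y',
  A X Y -> A X' Y' -> `|X - X'| < s%:Z -> `|Y - Y'| < k%:Z -> X = X' /\ Y = Y'.

Definition tight (s k r : nat) (A : int -> int -> Prop) := forall X Y, A X Y ->
  [/\ exists2 D : int, 0 < `|D| <= r%:Z & A (X + s%:Z) (Y + D),
      exists2 D : int, 0 < `|D| <= r%:Z & A (X - s%:Z) (Y + D),
      exists2 E : int, 0 < `|E| <= r%:Z & A (X + E) (Y + k%:Z)
    & exists2 E : int, 0 < `|E| <= r%:Z & A (X + E) (Y - k%:Z)].

(* Seen from the rectangle at the origin, let its right neighbour be shifted up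
   by [D]. Disjointness forces the rectangle below that neighbour to be shifted
   to the right, by [E], and the left neighbour of the latter to lie just below
   the origin: the four rectangles surround a hole of size [E] by [D]. *)
Lemma pinwheel_up (s k r : nat) A (D : int) : (r < s)%N -> (r < k)%N ->
  separated s k A -> tight s k r A -> A 0 0 -> A s%:Z D -> 0 < D <= r%:Z ->
  exists2 E : int, A E (- k%:Z) & A (s%:Z + E) (D - k%:Z).
Proof.
move=> rs rk sepA tiA A0 AD D_gt0; have [_ _ _ [E leE AB]] := tiA _ _ AD.
have E_gt0 : 0 < E.
  by rewrite ltNge; apply/negP => E_le0; have [] := sepA _ _ _ _ AB A0; lia.
have [_ [D' leD' AC] _ _] := tiA _ _ AB.
have DD' : D + D' <= 0.
  by rewrite leNgt; apply/negP => DD'; have [] := sepA _ _ _ _ AC A0; lia.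
have [_ _ [E' leE' AZ] _] := tiA _ _ AC.
have EE' : E + E' < s%:Z.
  by rewrite ltNge; apply/negP => EE'; have [] := sepA _ _ _ _ AZ AD; lia.
have [E0 D0] : E + E' = 0 /\ D + D' = 0 by have [] := sepA _ _ _ _ AZ A0; lia.
by exists E => //; have := AC; congr A; lia.
Qed.

Lemma pinwheel (s k r : nat) A (D : int) : (r < s)%N -> (r < k)%N ->
  separated s k A -> tight s k r A -> A 0 0 -> A s%:Z D -> 0 < `|D| <= r%:Z ->
  exists2 E : int, A E (- k%:Z) & A (s%:Z + E) (D - k%:Z).
Proof.
move=> rs rk sepA tiA A0 AD leD; case: (ltrP 0 D) => [D_gt0|D_le0].
  by apply: (pinwheel_up rs rk sepA tiA) => //; lia.
(* Reflecting the columns, with the right neighbour as new origin, turns a downward step into an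
   upward one. *)
pose A' (X Y : int) := A (s%:Z - X) (Y + D).
have sepA' : separated s k A'.
  by move=> X Y X' Y' AX AX' ltX ltY; have [] := sepA _ _ _ _ AX AX'; lia.
have tiA' : tight s k r A'.
  move=> X Y /tiA[[D1 le1 A1] [D2 le2 A2] [E1 le3 A3] [E2 le4 A4]].
  split; [exists D2|exists D1|exists (- E1)|exists (- E2)] => //; try lia.
  - by move: A2; rewrite /A'; congr A; lia.
  - by move: A1; rewrite /A'; congr A; lia.
  - by move: A3; rewrite /A'; congr A; lia.
  - by move: A4; rewrite /A'; congr A; lia.
have [|||E] := pinwheel_up (D := - D) rs rk sepA' tiA'.
- by rewrite /A' subr0 add0r.
- by rewrite /A' subrr addNr.
- lia.
rewrite /A' => AE AsE; exists (- E).
  by move: AsE; congr A; lia.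
by move: AE; congr A; lia.
Qed.
End Pinwheel.

(** * Commuting permutations and the divisibility condition *)

Section Necessity.
Local Open Scope ring_scope.
Variables (n : nat) (n_gt1 : (1 < n)%N).
Implicit Types (i j : 'Z_n) (X Y : int).
Variables (s k r : nat) (pi : {perm 'Z_n}).
Hypotheses (r_gt0 : (0 < r)%N) (rs : (r < s)%N) (rk : (r < k)%N).
Hypotheses (nE : n = (s * k + r)%N) (cf : clash_free s k pi).

Let at_ i X Y := pi (i + X%:~R) = pi i + Y%:~R.

Let bnd : [/\ (1 < s < n)%N, (1 < k < n)%N, (n < s.+1 * k)%N & (n < k.+1 * s)%N].
Proof. by split; nia. Qed.

Let at00 i : at_ i 0 0. Proof. by rewrite /at_ !addr0. Qed.

Let sep_at i : separated s k (at_ i).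
Proof.
case: bnd => s_n k_n _ _ X Y X' Y' AX AX' ltX ltY.
have /clash_freeP := cf; move=> /(_ n_gt1 (i + X'%:~R) _ (Y - Y') ltX ltY).
rewrite -addrA intr_addBK AX AX' -addrA intr_addBK => /(_ erefl) X0.
have {X0} EX : X = X' by have := intrZn_small n_gt1 _ X0; lia.
move: AX; rewrite /at_ EX AX' => /addrI/eqP.
rewrite eq_sym -subr_eq0 -intrB => /eqP/(intrZn_small n_gt1); lia.
Qed.

Let tight_at i : tight s k r (at_ i).
Proof.
case: bnd => s_n k_n n_s n_k X Y AX.
have stepX j : exists2 D : int, 0 < `|D| <= r%:Z & pi (j + s%:~R) = pi j + D%:~R.
  have [|D leD ED] := step_bound n_gt1 j s_n _ n_s cf; first lia.
  exists D => //; suff: D != 0 by lia.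
  apply/eqP => D0; move: ED; rewrite D0 addr0 -[in RHS](addr0 j).
  by move=> /perm_inj/addrI/(intrZn_small n_gt1); lia.
have stepY j : exists2 D : int, 0 < `|D| <= r%:Z &
    (pi^-1)%g (j + k%:~R) = (pi^-1)%g j + D%:~R.
  have [|D leD ED] := step_bound n_gt1 j k_n _ n_k (clash_freeV n_gt1 cf); first lia.
  exists D => //; suff: D != 0 by nia.
  apply/eqP => D0; move: ED; rewrite D0 addr0 -[in RHS](addr0 j).
  by move=> /perm_inj/addrI/(intrZn_small n_gt1); lia.
split.
- have [D leD ED] := stepX (i + X%:~R); exists D => //.
  by rewrite /at_ !intrD addrA ED AX addrA.
- have [D leD ED] := stepX (i + (X - s%:Z)%:~R); exists (- D); first lia.
  move: ED; rewrite -addrA -intrD subrK AX => ED.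
  by rewrite /at_ [(Y - D)%:~R]intrD intrN addrA ED addrK.
- have [E leE EE] := stepY (pi (i + X%:~R)); exists E => //.
  by rewrite /at_ !intrD !addrA -AX; move: EE; rewrite permK => <-; rewrite permKV.
- have [E leE EE] := stepY (pi (i + X%:~R) - k%:~R); exists (- E); first lia.
  move: EE; rewrite subrK permK => EE.
  by rewrite /at_ !intrD addrA EE !intrN addrK permKV AX addrA.
Qed.

Let t : {perm 'Z_n} := perm (addIr (s%:~R : 'Z_n)).
Let v : {perm 'Z_n} := perm (addIr ((- k%:Z)%:~R : 'Z_n)).
Let u : {perm 'Z_n} := (v ^ pi^-1)%g.

Let uE i : pi (u i) = pi i - k%:~R.
Proof. by rewrite /u conjgE invgK !permM permKV permE intrN. Qed.

(** The pinwheel at [i] gives [u i = i + E], and its fourth corner, in column [i + s + E], is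
    reached both as [t (u i)] and as [u (t i)]. *)
Lemma pinwheel_commute : commute t u.
Proof.
apply/permP => i; rewrite (permM t u) (permM u t); case: bnd => s_n k_n _ _.
have [[D leD AD] _ _ _] := tight_at (at00 i); rewrite !add0r in AD.
have [E AE AsE] := pinwheel rs rk (@sep_at i) (@tight_at i) (at00 i) AD leD.
have ui : u i = i + E%:~R by apply: (@perm_inj _ pi); rewrite uE AE intrN.
apply: (@perm_inj _ pi); rewrite uE ui !permE AD -[i + _ + _]addrA -intrD.
by rewrite [E + _]addrC AsE [(D - _)%:~R]intrD intrN addrA.
Qed.

Let G := (<[t]> <*> <[u]>)%G.
Let O : {set 'Z_n} := orbit 'P%act G 0.

Let O_t i : (t i \in O) = (i \in O).
Proof. by apply: (orbit_actr 'P%act); rewrite mem_gen // inE cycle_id. Qed.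

Let O_u i : (u i \in O) = (i \in O).
Proof.
by apply: (orbit_actr 'P%act); rewrite mem_gen // inE cycle_id orbT.
Qed.

Let O_s i : (i + s%:~R \in O) = (i \in O).
Proof. by rewrite -O_t permE. Qed.

Let O_k i j : pi j = pi i + k%:~R -> (j \in O) = (i \in O).
Proof.
move=> E; rewrite -O_u; congr (_ \in O).
by apply: (@perm_inj _ pi); rewrite uE E addrK.
Qed.

(* Induction on the distance [D] upwards from the rectangle at [x + p] to the
   one at [x + q]: the rectangle on top of the former, or its left or right
   neighbour, starts in the same window and lies between the two. *)
Lemma window_connected (x : 'Z_n) (D p q : nat) : (p < s)%N -> (q < s)%N ->
  pi (x + q%:~R) = pi (x + p%:~R) + D%:~R -> x + p%:~R \in O -> x + q%:~R \in O.
Proof.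
elim/ltn_ind: D p q => D IH p q lt_p lt_q ED Op.
have AD : at_ (x + p%:~R) (q%:Z - p%:Z) D by rewrite /at_ -addrA intr_addBK.
have A0 := at00 (x + p%:~R); have [_ _ [E leE AE] _] := tight_at A0.
rewrite !add0r in AE.
have OE : x + p%:~R + E%:~R \in O by rewrite (O_k AE).
have [X [Y [le_X leY [AY OX]]]] : exists X Y : int,
    [/\ 0 <= p%:Z + X < s%:Z, `|Y| <= r%:Z
      & at_ (x + p%:~R) X (k%:Z + Y) /\ x + p%:~R + X%:~R \in O].
  have [[D1 le1 A1] [D2 le2 A2] _ _] := tight_at AE.
  case: (ltrP (p%:Z + E) 0) => [lt0|ge0]; last case: (ltrP (p%:Z + E) s) => lts.
  - exists (E + s%:Z), D1; split; [lia|lia|split=> //].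
    by rewrite intrD addrA O_s.
  - by exists E, 0; split; [lia|lia|rewrite addr0].
  - exists (E - s%:Z), D2; split; [lia|lia|split=> //].
    by rewrite intrD intrN addrA -O_s subrK.
have [lt_k|le_k] := ltrP D%:Z k%:Z.
  suff -> : q = p by [].
  by have [] := sep_at AD A0; lia.
have [lt_D|le_D] := ltrP D%:Z (k%:Z + Y).
  by have [] := sep_at AY AD; lia.
(* The new start is in the window and higher by [k + Y], positive since [|Y| <= r < k]; so the
   distance drops. *)
pose p' := `|(p%:Z + X)%R|%N; have p'E : p'%:Z = p%:Z + X by lia.
apply: (IH `|(D%:Z - (k%:Z + Y))%R|%N _ p' q) => //; [lia|lia| |].
  rewrite p'E intrD addrA AY ED gez0_abs; last by lia.
  by rewrite -addrA intr_addBK.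
by rewrite p'E intrD addrA.
Qed.

(** Adjacent columns share a window because [1 < s]. *)
Lemma pinwheel_transitive : O = setT.
Proof.
case: bnd => s_n k_n _ _; apply/setP => i; rewrite in_setT -(natZnK i).
elim: (i : nat) => [|m IH]; first exact: orbit_refl.
have E : pi (m%:~R + 1%:~R) =
    pi (m%:~R + 0%:~R) + (pi (m%:~R + 1%:~R) - pi (m%:~R + 0%:~R) : 'Z_n)%R%:~R.
  by rewrite natZnK [RHS]addrC subrK.
have -> : m.+1%:~R = m%:~R + 1%:~R :> 'Z_n by rewrite -intrD -PoszD addn1.
by apply: (window_connected (p := 0) (q := 1) _ _ E); [lia|lia|rewrite addr0].
Qed.

Let order_shift (c : int) :
  (#[perm (addIr (c%:~R : 'Z_n))]%g %| n %/ gcdn n `|c|)%N.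
Proof.
rewrite order_dvdn; apply/eqP/permP => i; rewrite perm1.
have shiftE m : (perm (addIr (c%:~R : 'Z_n)) ^+ m)%g i = i + (m%:Z * c)%:~R.
  elim: m => [|m IH]; first by rewrite perm1 mul0r addr0.
  by rewrite expgSr permM IH permE -addrA -intrD; congr (_ + _%:~R); lia.
rewrite shiftE -[RHS]addr0; congr (_ + _); apply/eqP; rewrite intrZn_eq0 //.
rewrite dvdzE abszM absz_nat mulnC -muln_divCA_gcd; exact: dvdn_mulr.
Qed.

Lemma gcd_mul_dvd : (gcdn n s * gcdn n k %| n)%N.
Proof.
have cardO : #|O| = n by rewrite pinwheel_transitive cardsT card_ord Zp_cast.
have := dvdn_orbit 'P%act G 0; rewrite -/O cardO.
have cent_u : <[u]>%g \subset 'C(<[t]>)%g.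
  by rewrite cent_cycle cycle_subG; apply/cent1P/commute_sym/pinwheel_commute.
(* The order of the join times that of the intersection is [#[t] * #[u]]. *)
rewrite /= cent_joinEr // => /(dvdn_mulr #|<[t]> :&: <[u]>|%g).
rewrite -mul_cardG -!orderE orderJ => n_dvd.
have := dvdn_trans n_dvd (dvdn_mul (order_shift s) (order_shift (- k%:Z))).
rewrite abszN !absz_nat => {}n_dvd; have n_gt0 := ltnW n_gt1.
have nd : (n %/ gcdn n s * gcdn n s = n)%N by rewrite divnK ?dvdn_gcdl.
have ne : (n %/ gcdn n k * gcdn n k = n)%N by rewrite divnK ?dvdn_gcdl.
rewrite -(dvdn_pmul2l n_gt0) -[X in (_ %| X * _)%N]nd -[X in (_ %| _ * X)%N]ne.
by rewrite mulnACA dvdn_mul.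
Qed.
End Necessity.

(** * Constructions *)

Section Climb.
Local Open Scope ring_scope.
Local Open Scope nat_scope.
Variables (n : nat) (n_gt1 : (1 < n)%N).
Implicit Types (i j : 'Z_n) (X Y : int) (pi : {perm 'Z_n}).

Lemma val_addZn i (m : nat) : m < n ->
  (i + m%:~R)%R = (if i + m < n then i + m else i + m - n) :> nat.
Proof.
move=> lt_m; rewrite -pmulrn /= val_Zp_nat // (modn_small lt_m).
have := ltn_ord i; rewrite [X in _ < X]Zp_cast // => lt_i.
rewrite [X in _ %% X]Zp_cast //; case: ltnP => [/modn_small//|le_n].
by rewrite -[in LHS](subnK le_n) modnDr modn_small //; lia.
Qed.

Lemma ltn_Zn i : i < n.
Proof. by have := ltn_ord i; rewrite [X in _ < X]Zp_cast. Qed.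

Section Turn.
Variables (p q : nat).
Hypotheses (p_gt1 : 1 < p) (le_n : q.+1 * p <= n).

Let m := gcdn n q.+1.
Let N := n %/ m.

Let nE : n = m * N.
Proof. by rewrite mulnC divnK // dvdn_gcdl. Qed.

Let m_gt0 : 0 < m. Proof. by rewrite gcdn_gt0 orbT. Qed.

Let le_pN : p <= N.
Proof.
have le_m : m <= q.+1 by apply: dvdn_leq; rewrite // dvdn_gcdr.
rewrite -(leq_pmul2l m_gt0) -nE; apply: leq_trans le_n; exact: leq_mul.
Qed.

(* While [x] runs through [0, n), [level x] climbs from [0] to [m - 1],
   spending [N - 1] steps on each level, and then comes down one level at
   each step; the position skipped on a level on the way up is precisely the
   one used on the way down. *)
Let level (x : nat) := minn (x %/ N.-1) (n - 1 - x).

Let level_small x : x < n -> level x < m.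
Proof.
move=> lt_x; rewrite /level gtn_min; case: (ltnP x (m * N.-1)) => lt_xm.
  by rewrite ltn_divLR ?lt_xm //; lia.
by apply/orP; right; move: nE lt_xm le_pN p_gt1; case: N => [|N']; nia.
Qed.

(** Going up, each level lasts [N.-1 >= j] steps; going down, it lasts one; and both ends of the
    cycle are at level 0. *)
Let levelD (i : 'Z_n) (j : nat) : 0 < j < p ->
  (level i <= level (i + j%:~R)%R + j) && (level (i + j%:~R)%R <= level i + 1).
Proof.
move=> /andP[j_gt0 lt_jp]; have N1_gt0 : 0 < N.-1 by lia.
have lt_jn : j < n by nia.
have lt_in := ltn_Zn i.
rewrite (val_addZn i lt_jn) /level; case: ltnP => [lt_ij|le_ij].
  have le1 : (i + j) %/ N.-1 <= 1 + i %/ N.-1.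
    by rewrite -divnMDl //; apply: leq_div2r; lia.
  have le2 : i %/ N.-1 <= (i + j) %/ N.-1 by apply: leq_div2r; lia.
  by move: le1 le2; generalize (i %/ N.-1) ((i + j) %/ N.-1) => a b; lia.
have -> : (i + j - n) %/ N.-1 = 0 by apply: divn_small; lia.
by generalize (i %/ N.-1) => a; lia.
Qed.

(** Modulo [m], which divides [n] and [q.+1], only the level survives. Equal levels leave
    [q.+1 * (x - y)] divisible by [n], so [N] divides [x - y]; but the points of one level are
    distinct modulo [N]. *)
Let level_inj x y (c : int) : x < n -> y < n ->
  (q.+1 * x + level x)%N%:Z = ((q.+1 * y + level y)%N%:Z + c * n%:Z)%R -> x = y.
Proof.
move=> lt_x lt_y E; have [lt_lx lt_ly] := (level_small lt_x, level_small lt_y).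
have [q' Eq] : exists q', q.+1 = m * q'.
  by exists (q.+1 %/ m); rewrite mulnC divnK // dvdn_gcdr.
have co_Nq : coprime N q'.
  by rewrite /coprime -(eqn_pmul2l m_gt0) muln_gcdr -nE -Eq muln1.
rewrite Eq nE in E; have E2 : ((level x)%:Z - (level y)%:Z =
    m%:Z * (c * N%:Z + q'%:Z * (y%:Z - x%:Z)))%R by move: E; clear; nia.
have El : level x = level y.
  move: E2 lt_lx lt_ly; set w := (c * _ + _)%R; clearbody w; clear.
  by have [w_ge|w_le|->] := ltrgtP w 0%R; nia.
have [e Exy] : exists e : int, (x%:Z - y%:Z = e * N%:Z)%R.
  apply/dvdzP; rewrite -(@Gauss_dvdzr _ q') //; apply/dvdzP; exists c.
  by move: E m_gt0; rewrite El; clear; nia.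
have N_gt0 : 0 < N.-1 by lia.
have NE : N = N.-1.+1 by lia.
move: nE (divn_eq x N.-1) (divn_eq y N.-1).
move: (ltn_pmod x N_gt0) (ltn_pmod y N_gt0) El.
rewrite /level; rewrite NE in Exy *; move: Exy; rewrite /=.
generalize (x %% N.-1) (y %% N.-1) (x %/ N.-1) (y %/ N.-1).
move: lt_x lt_y; clear -p_gt1; generalize n m N.-1 => n' m' d.
move=> lt_x lt_y a a' b b' Exy lt_a lt_a' El nE Ex Ey.
have e0 (z w : int) :
    (e * d.+1%:Z + z * d.+1%:Z = w -> `|w| < d.+1%:Z -> w = 0)%R.
  rewrite -mulrDl => <-; move: (e + z)%R => v; clear.
  by have [v_lt|v_gt|->] := ltrgtP v 0%R; nia.
rewrite -Exy in e0; clear Exy.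
(* Modulo [d.+1], the points of level [b] on the way up are [a - b] with [a < d]; the one on the way
   down is [d - b]. *)
case: (leqP b (n' - 1 - x)) => lx; case: (leqP b' (n' - 1 - y)) => ly.
- have bb : b = b' by lia.
  by have := e0 0%R _ erefl; rewrite mul0r; subst b'; lia.
- by have := e0 (m'%:Z - b%:Z)%R _ erefl; rewrite mulrBl; lia.
- by have := e0 (b'%:Z - m'%:Z)%R _ erefl; rewrite mulrBl; lia.
- lia.
Qed.

Let turn (i : 'Z_n) : 'Z_n := ((q.+1 * i + level i)%N%:~R)%R.

Let turn_inj : injective turn.
Proof.
move=> i j /(intrZn_eq n_gt1)[c E].
by apply: val_inj => /=; apply: level_inj (ltn_Zn i) (ltn_Zn j) E.
Qed.

Lemma turn_clash_free : exists pi : {perm 'Z_n}, clash_free p q pi.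
Proof.
exists (perm turn_inj); apply/clash_free_pos => // i j Y j_p ltY.
rewrite !permE /turn -intrD => /(intrZn_eq n_gt1)[c E].
have lt_jn : j < n by nia.
have /andP[le1 le2] := levelD i j_p.
have [b Eb] : exists b : int, ((i + j%:~R : 'Z_n)%R : nat)%:Z = (i%:Z + j%:Z + b * n%:Z)%R.
  rewrite (val_addZn i lt_jn); case: ltnP => lt; [exists 0%R | exists (-1)%R]; lia.
(* The advance over [j] steps is between [q * j] and [q.+1 * j + 1 <= n - q], so [W] would be a
   multiple of [n] strictly between 0 and [n]. *)
pose W : int := (q.+1%:Z * j%:Z + ((level (i + j%:~R)%R)%:Z - (level i)%:Z) - Y)%R.
have EW : W = ((c - b * q.+1%:Z) * n%:Z)%R by rewrite /W; move: E Eb; nia.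
have /andP[j_gt0 lt_jp] := j_p.
have ge_q : q <= q * j by rewrite leq_pmulr.
have le_p : q.+1 * j + q.+1 <= n by rewrite -mulnSr (leq_trans _ le_n) ?leq_mul.
rewrite mulSn in le_p; have W_gt0 : (0 < W)%R.
  by rewrite /W -PoszM mulSn; clear -le1 ltY ge_q; lia.
have W_lt : (W < n%:Z)%R.
  by rewrite /W -PoszM mulSn; clear -le2 ltY le_p; lia.
move: W_gt0 W_lt; rewrite EW; move: (c - _)%R => v; clear.
by have [v_lt|v_gt|->] := ltrgtP v 0%R; nia.
Qed.
End Turn.

Lemma exists_clash_free p q : 0 < p -> q.+1 * p <= n ->
  exists pi : {perm 'Z_n}, clash_free p q pi.
Proof.
case: p => [//|[|p]] _ le_n; last exact: turn_clash_free le_n.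
by exists 1%g; apply: clash_free1.
Qed.
End Climb.

(** * The staircase permutation *)

Section Stair.
Local Open Scope ring_scope.

(** For positive [q] and [h], this is the identity on [[0, q)], extended so as to gain [q * h] over
    each period [q]. *)
Definition stair (q h : nat) (a : int) : int :=
  a + h.-1%:Z * q%:Z * (a %/ q%:Z)%Z.

Lemma stair_lt q h a b : a < b -> stair q h a < stair q h b.
Proof.
move=> lt_ab; rewrite /stair ltr_leD // ler_wpM2l //.
by apply: lez_pdiv2r => //; exact: ltW.
Qed.

Lemma stair_addMl q h a m : (0 < q)%N -> (0 < h)%N ->
  stair q h (m * q%:Z + a) = stair q h a + m * q%:Z * h%:Z.
Proof.
move=> q_gt0 h_gt0; rewrite /stair divzMDl; last by lia.
by rewrite -[in X in _ = _ + X](prednK h_gt0) -[_.+1]addn1 PoszD; ring.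
Qed.

Lemma stair_small q h (a : nat) : (a < q)%N -> stair q h a = a.
Proof. by move=> lt_a; rewrite /stair divz_small ?mulr0 ?addr0; lia. Qed.

Lemma stair_mod q h a : exists m : int, stair q h a = a + m * q%:Z.
Proof. by exists (h.-1%:Z * (a %/ q%:Z)%Z); rewrite /stair; ring. Qed.

(* Both coordinates of [(s a + S b, D a - k b)] increase strictly with [a],
   while the first increases and the second decreases with [b]. *)
Lemma staircase_separated (s k q h q' h' : nat) (a b a' b' : int) :
  `|s%:Z * a' + stair q' h' b' - (s%:Z * a + stair q' h' b)| < s%:Z ->
  `|stair q h a' - k%:Z * b' - (stair q h a - k%:Z * b)| < k%:Z ->
  a = a' /\ b = b'.
Proof.
have [lt_a|lt_a|->] := ltrgtP a a'; have [lt_b|lt_b|->] := ltrgtP b b' => //.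
- have := stair_lt q' h' lt_b; nia.
- have := stair_lt q h lt_a; nia.
- nia.
- have := stair_lt q h lt_a; nia.
- have := stair_lt q' h' lt_b; nia.
- nia.
- nia.
- nia.
Qed.
End Stair.

Section Staircase.
Local Open Scope ring_scope.
(* The window is [d * s] and the separation [e * k]. *)
Variables (n d e s k t u v : nat) (n_gt1 : (1 < n)%N).
Hypotheses (nE : n = (d * e * (s * k + t))%N) (t_gt0 : (0 < t)%N).
Hypotheses (co_dk : coprime d k) (uv : (u * s = v * (e * (s * k + t)) + 1)%N).

Let a (x : nat) := (u * (x %/ d))%N.
Let b (x : nat) := (x %% d)%N.

Let d_gt0 : (0 < d)%N. Proof. lia. Qed.
Let e_gt0 : (0 < e)%N. Proof. lia. Qed.

Let b_small x : (b x < d)%N. Proof. exact: ltn_pmod. Qed.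

(** [u] inverts [s] modulo [n / d], so [d * s * a x] is [d * (x %/ d)] modulo [n]. *)
Let abE x : exists m : int, (d * s)%N%:Z * (a x)%:Z + (b x)%:Z = x%:Z + m * n%:Z.
Proof.
exists (v * (x %/ d))%N%:Z; rewrite [X in _ = X%:Z + _](divn_eq x d) /a /b.
generalize (x %/ d)%N (x %% d)%N => y z; rewrite nE.
by rewrite !PoszD !PoszM; move: (congr1 Posz uv); rewrite !PoszD !PoszM => E; ring: E.
Qed.

(* [x] is the first coordinate of the point with parameters [(a x, b x)] of
   the staircase, and [f x] is its second coordinate. *)
Let f (x : nat) : int := stair e d (a x) - (e * k)%N%:Z * (b x)%:Z.

(** The factors of [n] are peeled off in turn: modulo [e] the stair is the identity, so [a x] and
    [a y] agree; [k] is invertible modulo [d], so [b x = b y]; what remains makes [A] a multiple of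
    [s * k + t]. *)
Let f_inj x y (m : int) : (x < n)%N -> (y < n)%N -> f x = f y + m * n%:Z -> x = y.
Proof.
move=> lt_x lt_y E.
have [A EA] : exists A : int, (a x)%:Z = A * e%:Z + (a y)%:Z.
  have [mx Ex] := stair_mod e d (a x); have [my Ey] := stair_mod e d (a y).
  exists (my - mx + k%:Z * ((b x)%:Z - (b y)%:Z) + m * (d * (s * k + t))%N%:Z).
  move: E; rewrite /f Ex Ey [in n%:Z]nE !PoszM => E; lia.
have E2 : A * d%:Z - k%:Z * ((b x)%:Z - (b y)%:Z) = m * (d * (s * k + t))%N%:Z.
  apply: (@mulfI _ e%:Z); first by lia.
  move: E; rewrite /f EA stair_addMl // [in n%:Z]nE !PoszM => E; lia.
have bxy : (b x)%:Z = (b y)%:Z.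
  have : (d %| (b x)%:Z - (b y)%:Z)%Z.
    rewrite -(@Gauss_dvdzr _ k) //; apply/dvdzP.
    by exists (A - m * (s * k + t)%N%:Z); move: E2; rewrite !PoszM => E2; lia.
  case/dvdzP => z; have := b_small x; have := b_small y; generalize (b x) (b y); clear.
  by have [z_lt|z_gt|->] := ltrgtP z 0; nia.
have {}E2 : A = m * (s * k + t)%N%:Z.
  by apply: (@mulfI _ d%:Z); [lia|move: E2; rewrite bxy !PoszM => E2; lia].
have [mx Ex] := abE x; have [my Ey] := abE y.
have Exy : x%:Z - y%:Z = (m * s%:Z + my - mx) * n%:Z.
  move: Ex Ey; rewrite EA E2 bxy nE !PoszM => Ex Ey; lia.
move: Exy lt_x lt_y; move: (_ + my - _) => z; clear.
by have [z_lt|z_gt|->] := ltrgtP z 0; nia.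
Qed.

Let step (i : 'Z_n) : 'Z_n := (f i)%:~R.

Lemma staircase_inj : injective step.
Proof.
move=> i j /(intrZn_eq n_gt1)[c E].
by apply: val_inj => /=; apply: f_inj (ltn_Zn n_gt1 i) (ltn_Zn n_gt1 j) E.
Qed.

Lemma staircase_clash_free : clash_free (d * s) (e * k) (perm staircase_inj).
Proof.
apply/clash_freeP => // i X Y ltX ltY; pose j : 'Z_n := i + X%:~R.
rewrite !permE /step -intrD.
move=> /(intrZn_eq n_gt1)[m2 E2].
have [m0 E0] := abE i; have [m1 E1] := abE j.
have [m3 E3] : exists m3 : int, (j : nat)%:Z = i%:Z + X + m3 * n%:Z.
  by apply: (intrZn_eq n_gt1); rewrite intrD !natZnK /j.
pose m := m1 + m3 - m0; move: E1 E2; rewrite -/j E3 /f.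
move: (a _) (b _) (b_small j) => a' b' lt_b' E1 E2.
move: (a _) (b _) (b_small i) E0 E2 => a0 b0 lt_b0 E0 E2.
(* Moving by the periods of the staircase turns the congruences mod [n] into
   equalities. *)
pose a2 := (- m * k%:Z - m2 * t%:Z) * e%:Z + a'%:Z.
pose b2 := (- m + m2 * s%:Z) * d%:Z + b'%:Z.
have et_gt0 : (0 < e * t)%N by rewrite muln_gt0 e_gt0.
have S2 : stair d (e * t) b2 = b'%:Z + (- m + m2 * s%:Z) * d%:Z * (e * t)%N%:Z.
  by rewrite stair_addMl // stair_small.
have D2 : stair e d a2 = stair e d a' + (- m * k%:Z - m2 * t%:Z) * e%:Z * d%:Z.
  by rewrite stair_addMl.
(* With [A] and [B] the factors of [e] in [a2] and of [d] in [b2], [s A + t B = - m (s k + t)] is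
   used here and [A - k B = - m2 (s k + t)] below. *)
have EX : (d * s)%N%:Z * a2 + stair d (e * t) b2 -
    ((d * s)%N%:Z * a0%:Z + stair d (e * t) b0) = X.
  rewrite S2 (stair_small _ lt_b0) /a2 /m; move: E0 E1.
  move: (i : nat) => x; rewrite nE !PoszM !PoszD !PoszM => E0 E1; lia.
have EY : stair e d a2 - (e * k)%N%:Z * b2 -
    (stair e d a0 - (e * k)%N%:Z * b0%:Z) = Y.
  rewrite D2 /b2 /m; move: E2; rewrite nE !PoszM !PoszD !PoszM => E2; lia.
have [||Ea Eb] := @staircase_separated (d * s) (e * k) e d d (e * t) a0 b0 a2 b2.
- by rewrite EX.
- by rewrite EY.
by rewrite -EX -Ea -Eb subrr.
Qed.
End Staircase.

(** * The value of sigma *)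

Lemma sigma_eq n k m (pi : {perm 'Z_n}) : 0 < m < n -> clash_free m k pi ->
  (forall s (rho : {perm 'Z_n}), s < n -> clash_free s k rho -> s <= m) ->
  sigma n k = m.
Proof.
move=> m_n cf max_m; apply/eqP; rewrite eqn_leq /sigma; apply/andP; split.
  apply/bigmax_leqP_seq => s; rewrite mem_index_iota => /andP[_ lt_sn].
  by case/existsP => rho; apply: max_m.
apply: (@leq_bigmax_seq _ _ _ id); first by rewrite mem_index_iota.
by apply/existsP; exists pi.
Qed.

(** Dividing [n] and [s], or [n] and [k], by their gcd leaves the coprime cofactors that the
    staircase needs; its [t] is [r] divided by both gcds. *)
Lemma exists_staircase n s k r : 1 < n -> n = s * k + r -> 0 < r ->
  0 < s -> 0 < k -> gcdn n s * gcdn n k %| n ->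
  exists pi : {perm 'Z_n}, clash_free s k pi.
Proof.
move=> n_gt1 nE r_gt0 s_gt0 k_gt0; set d := gcdn n s; set e := gcdn n k.
have [d_gt0 e_gt0] : 0 < d /\ 0 < e by rewrite !gcdn_gt0 s_gt0 k_gt0 !orbT.
case/dvdnP => c nc; have [s1 Es] := dvdnP (dvdn_gcdr n s : d %| s).
have [k1 Ek] := dvdnP (dvdn_gcdr n k : e %| k).
have co_s : coprime s1 (e * c).
  rewrite /coprime -(eqn_pmul2l d_gt0) muln_gcdr muln1; apply/eqP.
  by rewrite gcdnC; transitivity (gcdn n s); rewrite //; congr gcdn; lia.
have co_k : coprime (d * c) k1.
  rewrite /coprime -(eqn_pmul2l e_gt0) muln_gcdr muln1; apply/eqP.
  by transitivity (gcdn n k); rewrite //; congr gcdn; lia.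
have cE : c = s1 * k1 + (c - s1 * k1) by nia.
have t_gt0 : 0 < c - s1 * k1 by nia.
have s1_gt0 : 0 < s1 by lia.
have [u v uv _] := egcdnP (e * c) s1_gt0.
rewrite (eqP co_s) {1}cE in uv.
rewrite Es Ek [s1 * d]mulnC [k1 * e]mulnC.
have nE' : n = d * e * (s1 * k1 + (c - s1 * k1)) by rewrite -cE; lia.
have co_dk : coprime d k1 by move: co_k; rewrite coprimeMl => /andP[].
by exists (perm (staircase_inj n_gt1 nE' t_gt0 co_dk uv)); apply: staircase_clash_free.
Qed.

Theorem theorem1 (n k s r : nat) (hk : 0 < k) (hkn : k < n)
    (hs : s = (n - 1) %/ k) (hn : n = s * k + r) (hr : 1 <= r <= k) :
  [/\ (r >= s \/ k = r) -> sigma n k = (n - 1) %/ k,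
      r < s -> r < k -> gcdn n s * gcdn n k %| n ->
        sigma n k = (n - 1) %/ k
    & r < s -> r < k -> ~~ (gcdn n s * gcdn n k %| n) ->
        sigma n k = (n - 1) %/ k - 1].
Proof.
have n_gt1 : 1 < n by lia.
have s_n : 0 < s < n by move: hkn; rewrite hn; clear hs; nia.
have upper s' (rho : {perm 'Z_n}) : s' < n -> clash_free s' k rho -> s' <= s.
  move=> lt_s' /(clash_free_mul_lt n_gt1 lt_s') lt_n.
  have {}lt_n : s' * k < n by apply: lt_n; lia.
  by clear hs; nia.
rewrite -hs; clear hs; split.
- move=> r_s_k.
  have [pi cf] : exists pi : {perm 'Z_n}, clash_free s k pi.
    (* If [s <= r] then [k.+1 * s <= n]; if [k = r] then [n = s.+1 * k], and the roles of [s] and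
       [k] are exchanged by inversion. *)
    case: r_s_k => [le_sr|kr].
      by apply: exists_clash_free => //; [lia | nia].
    have [||pi cf] := @exists_clash_free n n_gt1 k s => //; first by nia.
    by exists pi^-1%g; apply: clash_freeV.
  exact: sigma_eq cf upper.
- move=> _ _ /(exists_staircase n_gt1 hn)[||| pi cf] //; try lia.
  exact: sigma_eq cf upper.
move=> lt_rs lt_rk ndvd.
(* Lowering the window to [s - 1] asks only for [s * k <= n]. *)
have [||pi cf] := @exists_clash_free n n_gt1 k (s - 1) => //; first by nia.
apply: (sigma_eq (pi := pi^-1%g)); [lia | exact: clash_freeV |].
move=> s' rho lt_s' cf'; have := upper _ _ lt_s' cf'.
rewrite leq_eqVlt => /orP[/eqP Es|]; last by lia.
rewrite Es in cf'; case/negP: ndvd.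
by apply: gcd_mul_dvd lt_rs lt_rk hn cf' => //; lia.
Qed.
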